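(* Let $X$ be a Banach space and let $(A,D(A))$ be the generator of a $C_0$-semigroup $(T(t))_{t\ge0}$ on $X$ such that $T(t)$ is a compact operator for each $t>0$. Let $f(t,x)=\varphi(t)g(x)+\psi(t)$, where $\varphi\in AAS^1(\mathbb{R},\mathbb{R})\cap L^\infty(\mathbb{R},\mathbb{R})$, $\psi\in AAS^1(\mathbb{R},X)$, and $g:X\to X$ is continuous and maps bounded subsets of $X$ to bounded subsets. If $x_0:[t_0,+\infty)\to X$ (for some $t_0\in\mathbb{R}$) is a bounded mild solution of the equation $x'(t)=Ax(t)+f(t,x(t))$, then $x_0$ has relatively compact range.
   Context: Mild solution on $[t_0,\infty)$: a continuous $x:[t_0,\infty)\to X$ with $x(t)=T(t-\sigma)x(\sigma)+\int_\sigma^t T(t-s)f(s,x(s))\,ds$ for all $t\ge\sigma\ge t_0$. For a Banach space $Y$, $AAS^1(\mathbb{R},Y)$ is the set of $u\in L^1_{loc}(\mathbb{R},Y)$ such that every real sequence has a subsequence $(s_n)$ and a function $v\in L^1_{loc}(\mathbb{R},Y)$ with, for each $t\in\mathbb{R}$, $\lim_n\int_t^{t+1}\|u(s+s_n)-v(s)\|ds=0$ and $\lim_n\int_t^{t+1}\|v(s-s_n)-u(s)\|ds=0$. *)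

(* Defs.v *)
From HB Require Import structures.
From mathcomp Require Import all_boot all_order all_algebra.
From mathcomp Require Import all_classical all_reals all_analysis.

Set Implicit Arguments.
Unset Strict Implicit.
Unset Printing Implicit Defensive.

Import Order.TTheory GRing.Theory Num.Theory.
Import numFieldNormedType.Exports.

Local Open Scope classical_set_scope.
Local Open Scope ring_scope.

(* Bochner integration.  MathComp-Analysis integrates only extended-real valued
   functions and its [lebesgue_measure] lives on the Borel sigma-algebra, so
   measurability is understood in the strong sense and up to a null set.  For
   such an [f], the function [x |-> `|f x|] need not be Borel, but it agrees
   outside a Borel null set with a Borel function.  The library integral of a
   nonnegative function is the supremum of the integrals of the simple functions
   below it, whence [\int[mu]_(x in D) `|f x|%:E] is the integral with respect
   to the completion of [mu]. *)
Section Bochner.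
Context {d : measure_display} {T : measurableType d} {R : realType}.
Context {X : normedModType R}.
Implicit Types (mu : {measure set T -> \bar R}) (D : set T) (s f : T -> X).

Definition vsimple s : Prop :=
  finite_set (range s) /\ forall y, measurable (s @^-1` [set y]).

Definition vsimple_integrable mu D s : Prop :=
  vsimple s /\ forall y, y != 0 -> (mu (D `&` s @^-1` [set y]) < +oo)%E.

Definition vsimple_integral mu D s : X :=
  \sum_(y \in range s) fine (mu (D `&` s @^-1` [set y])) *: y.

Definition strongly_measurable mu D f : Prop :=
  exists2 s_ : nat -> T -> X, (forall n, vsimple (s_ n)) &
    \forall x \ae mu, D x -> s_ n x @[n --> \oo] --> f x.

Definition is_bochner_integral mu D f (I : X) : Prop :=
  strongly_measurable mu D f /\
  exists s_ : nat -> T -> X,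
    [/\ forall n, vsimple_integrable mu D (s_ n),
        (\int[mu]_(x in D) (`|f x - s_ n x|%:E))%E @[n --> \oo] --> 0%E &
        vsimple_integral mu D (s_ n) @[n --> \oo] --> I].

Definition bochner_integrable mu D f : Prop :=
  exists I, is_bochner_integral mu D f I.

(* Junk value 0 when [f] is not Bochner integrable on [D]. *)
Definition bochner_integral mu D f : X := xget 0 (is_bochner_integral mu D f).

End Bochner.

Section FunctionSpaces.
Context {R : realType} {Y : normedModType R}.
Local Notation mu := (@lebesgue_measure R).

(* Members of L^1_loc and L^oo are represented by functions defined everywhere;
   nothing below depends on their values on a null set. *)
Definition L1loc (u : R -> Y) : Prop :=
  strongly_measurable mu setT u /\
  forall K : set R, compact K -> (\int[mu]_(t in K) (`|u t|%:E) < +oo)%E.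

Definition Linfty (u : R -> Y) : Prop :=
  strongly_measurable mu setT u /\
  ('N[mu]_(+oo)[(fun t => `|u t|%:E)] < +oo)%E.

Definition AAS1 (u : R -> Y) : Prop :=
  L1loc u /\
  forall r : nat -> R, exists k : nat -> nat,
    {homo k : m n / (m < n)%N} /\
    exists v : R -> Y,
      [/\ L1loc v,
          forall t : R,
            (\int[mu]_(s in `[t, (t + 1)%R]) (`|u (s + r (k n)) - v s|%:E))%E
              @[n --> \oo] --> 0%E &
          forall t : R,
            (\int[mu]_(s in `[t, (t + 1)%R]) (`|v (s - r (k n)) - u s|%:E))%E
              @[n --> \oo] --> 0%E].

End FunctionSpaces.

Section Evolution.
Context {R : realType} {X : normedModType R}.
Local Notation mu := (@lebesgue_measure R).

(* Only the values [T t] with [0 <= t] matter. *)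
Definition C0_semigroup (T : R -> X -> X) : Prop :=
  [/\ forall t, 0 <= t -> linear (T t) /\ continuous (T t),
      T 0 = id,
      forall s t, 0 <= s -> 0 <= t -> T (s + t) = T s \o T t &
      forall x, T t x @[t --> 0^'+] --> x].

(* [A] is only meaningful on its domain [D]. *)
Definition is_generator (D : set X) (A : X -> X) (T : R -> X -> X) : Prop :=
  forall x y, (D x /\ A x = y) <->
    (h^-1 *: (T h x - x)) @[h --> 0^'+] --> y.

Definition compact_operator (S : X -> X) : Prop :=
  [/\ linear S, continuous S &
      forall B : set X, bounded_set B -> precompact (S @` B)].

(* Mild solution on [t0, +oo) of x' = A x + f(t, x), where T is the semigroup
   generated by A; only the restriction of [x] to [t0, +oo) matters. *)
Definition mild_solution (T : R -> X -> X) (f : R -> X -> X) (t0 : R)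
    (x : R -> X) : Prop :=
  {within `[t0, +oo[, continuous x} /\
  forall sigma t, t0 <= sigma -> sigma <= t ->
    let F := (fun s => T (t - s) (f s (x s))) in
    bochner_integrable mu `[sigma, t] F /\
    x t = T (t - sigma) (x sigma) + bochner_integral mu `[sigma, t] F.

End Evolution.

(* Main.v *)
Require Import Defs.
From HB Require Import structures.
From mathcomp Require Import all_boot all_order all_algebra.
From mathcomp Require Import all_classical all_reals all_analysis.
From mathcomp Require Import finmap measurable_realfun.
From mathcomp Require Import ring lra.

Import Order.TTheory GRing.Theory Num.Theory.
Import numFieldNormedType.Exports.

Local Open Scope classical_set_scope.
Local Open Scope ring_scope.

(* For small h > 0 and t >= t0 + h,
   x0(t) = T(h) x0(t - h) + \int_(t-h)^t T(t - s) f(s, x0(s)) ds.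
   The first term stays in the relatively compact image under T(h) of the range
   of x0.  The second one is small uniformly in t: T is bounded near 0
   (Banach-Steinhaus), g is bounded on the range of x0, and
   \int_(t-h)^t |u| -> 0 as h -> 0, uniformly in t, for every u in AAS^1.
   Indeed, if \int_(t_n - h_n)^(t_n) |u| > e with h_n -> 0, then along a
   subsequence u(. + t_n) converges in L^1([-1, 0]) to some v, and
   \int_(-h_n)^0 |v| -> 0 by absolute continuity.  On [t0, t0 + h] continuity
   suffices, so the range of x0 is totally bounded. *)

(** * Inequalities for integrals of nonnegative functions that need not be measurable *)

Section IntegralNonMeasurable.
Context {d : measure_display} {U : measurableType d} {R : realType}.
Variable mu : {measure set U -> \bar R}.
Local Open Scope ereal_scope.
Import HBNNSimple.

Lemma le_ge0_integral (D : set U) (f g : U -> \bar R) :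
  (forall x, D x -> 0 <= f x) -> (forall x, D x -> f x <= g x) ->
  \int[mu]_(x in D) f x <= \int[mu]_(x in D) g x.
Proof.
move=> f0 fg.
have g0 x : D x -> 0 <= g x by move=> Dx; exact: le_trans (f0 _ Dx) (fg _ Dx).
rewrite !ge0_integralE//; apply: ereal_sup_le => _ [h hf <-].
exists h => //= x; apply: le_trans (hf x) _.
exact: lee_restrict.
Qed.

Lemma subset_ge0_integral (A B : set U) (f : U -> \bar R) :
  A `<=` B -> (forall x, B x -> 0 <= f x) ->
  \int[mu]_(x in A) f x <= \int[mu]_(x in B) f x.
Proof.
move=> AB f0; rewrite integral_mkcond [leRHS]integral_mkcond.
apply: le_ge0_integral => x _; rewrite !patchE.
  by case: ifPn => // /set_mem/AB/f0.
case: ifPn => [/set_mem/AB Bx|_]; first by rewrite mem_set.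
by case: ifPn => // /set_mem/f0.
Qed.

Variable D : set U.
Hypothesis mD : measurable D.

(** Reduces an upper bound for a non-measurable [f] to measurable functions below it, to which the
    usual rules apply. The simple functions in the defining supremum vanish outside [D], so their
    full integrals are integrals over [D]. *)
Lemma integral_le_measurable_minorants (f : U -> \bar R) (c : \bar R) :
  (forall x, D x -> 0 <= f x) ->
  (forall h : U -> R, measurable_fun setT h -> (forall x, 0 <= h x)%R ->
    (forall x, D x -> (h x)%:E <= f x) -> \int[mu]_(x in D) (h x)%:E <= c) ->
  \int[mu]_(x in D) f x <= c.
Proof.
move=> f0 H; rewrite ge0_integralE//; apply: ge_ereal_sup => _ [h /= hf <-].
have -> : sintegral mu h = \int[mu]_(x in D) (h x)%:E.
  rewrite -integralT_nnsfun [RHS]integral_mkcond; apply: eq_integral => x _.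
  rewrite patchE; case: ifPn => // xD; apply/eqP.
  rewrite eq_le !lee_fin fun_ge0 andbT -lee_fin.
  by rewrite (le_trans (hf x))// patchE (negbTE xD).
apply: H => // x Dx; by rewrite (le_trans (hf x))// patchE mem_set.
Qed.

(** Removing the null set [N] leaves the integral of a measurable minorant of [f] unchanged, and
    outside [N] this minorant lies below [g]. *)
Lemma ae_le_ge0_integral (f g : U -> \bar R) :
  (forall x, D x -> 0 <= f x) -> (forall x, D x -> 0 <= g x) ->
  {ae mu, forall x, D x -> f x <= g x} ->
  \int[mu]_(x in D) f x <= \int[mu]_(x in D) g x.
Proof.
move=> f0 g0 [N [mN N0 subN]]; apply: integral_le_measurable_minorants => //.
move=> h mh h0 hf.
rewrite (@ge0_negligible_integral _ _ _ _ _ N)//; last 2 first.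
- by apply/measurable_EFinP; exact: measurable_funTS.
- by move=> x _; rewrite lee_fin.
rewrite integral_mkcond [leRHS]integral_mkcond.
apply: le_ge0_integral => x _; rewrite !patchE.
  by case: ifP => // _; rewrite lee_fin.
case: ifPn => xDN; last by case: ifPn => // /set_mem/g0.
move: xDN => /set_mem[Dx Nx]; rewrite mem_set//.
apply: le_trans (hf _ Dx) _; apply: contrapT => nle; apply/Nx/subN => /=.
by move/(_ Dx).
Qed.

(* The integral of a non-measurable function is a lower integral, which is only
   superadditive: additivity requires one of the two summands to be
   a.e. measurable. *)
Lemma ge0_le_integralD (k f g : U -> \bar R) (g' : U -> R) :
  (forall x, D x -> 0 <= k x) -> (forall x, D x -> 0 <= f x) ->
  (forall x, D x -> 0 <= g x) ->
  measurable_fun setT g' -> (forall x, 0 <= g' x)%R ->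
  {ae mu, forall x, D x -> g x = (g' x)%:E} ->
  (forall x, D x -> k x <= f x + g x) ->
  \int[mu]_(x in D) k x <= \int[mu]_(x in D) f x + \int[mu]_(x in D) g x.
Proof.
move=> k0 f0 g0 mg' g'0 gg' kfg; apply: integral_le_measurable_minorants => //.
move=> h mh h0 hk.
(* Cut the minorant [h] at the height [g']: both pieces are measurable, and almost everywhere on [D]
   the excess is at most [f] and the rest at most [g]. *)
have -> : \int[mu]_(x in D) (h x)%:E =
    \int[mu]_(x in D) (Num.max (h x - g' x) 0)%:E +
    \int[mu]_(x in D) (Num.min (h x) (g' x))%:E.
  rewrite -ge0_integralD//.
  - apply: eq_integral => x _; rewrite -EFinD; congr EFin.
    have [hg|/ltW hg] := leP (h x) (g' x).
      by rewrite max_r ?subr_le0// add0r.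
    by rewrite max_l ?subr_ge0// subrK.
  - by move=> x _; rewrite lee_fin le_max lexx orbT.
  - apply/measurable_EFinP/measurable_funTS; apply: measurable_maxr => //.
    exact: measurable_funB.
  - by move=> x _; rewrite lee_fin le_min h0 g'0.
  - apply/measurable_EFinP/measurable_funTS; exact: measurable_minr.
apply: leeD; apply: ae_le_ge0_integral => //.
- by move=> x _; rewrite lee_fin le_max lexx orbT.
- apply: filterS gg' => x gg' Dx; have {}gg' := gg' Dx.
  rewrite EFin_max ge_max f0// andbT EFinB leeBlDr// -gg'.
  exact: le_trans (hk _ Dx) (kfg _ Dx).
- by move=> x _; rewrite lee_fin le_min h0 g'0.
- apply: filterS gg' => x /[apply] ->; by rewrite lee_fin ge_min lexx orbT.
Qed.

(** Dividing a measurable minorant of [c * f] by [c] gives a minorant of [f]. *)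
Lemma ge0_le_integralZl (f : U -> \bar R) (c : R) : (0 < c)%R ->
  (forall x, D x -> 0 <= f x) ->
  \int[mu]_(x in D) (c%:E * f x) <= c%:E * \int[mu]_(x in D) f x.
Proof.
move=> c0 f0; apply: integral_le_measurable_minorants.
  by move=> x /f0; rewrite pmule_rge0.
move=> h mh h0 hf; rewrite -lee_pdivrMl// -ge0_integralZl//.
- apply: le_ge0_integral => x Dx.
    by rewrite -EFinM lee_fin mulr_ge0// invr_ge0 ltW.
  by rewrite lee_pdivrMl// hf.
- by apply/measurable_EFinP; exact: measurable_funTS.
- by move=> x _; rewrite lee_fin.
- by rewrite lee_fin invr_ge0 ltW.
Qed.

End IntegralNonMeasurable.

(** * Norm estimate for the Bochner integral *)

Section BochnerNorm.
Context {d : measure_display} {U : measurableType d} {R : realType}.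
Context {X : normedModType R}.
Variable mu : {measure set U -> \bar R}.

Lemma vsimple_preimage (s : U -> X) (B : set X) :
  vsimple s -> measurable (s @^-1` B).
Proof.
move=> [sfin sm]; rewrite (_ : s @^-1` B =
    \bigcup_(y in range s `&` B) s @^-1` [set y]).
  by apply: fin_bigcup_measurable => //; exact: finite_setIl.
apply/seteqP; split => [x Bx|x [y [_ By] /= ->]//].
by exists (s x) => //; split => //; exists x.
Qed.

Lemma measurable_vsimple_norm (s : U -> X) :
  vsimple s -> measurable_fun setT (fun x => `|s x|).
Proof.
by move=> vs _ B _; rewrite setTI; exact: (vsimple_preimage _ (Num.norm @^-1` B) vs).
Qed.

Lemma strongly_measurable_norm (D : set U) (u : U -> X) :
  strongly_measurable mu D u ->
  exists v : U -> R, [/\ measurable_fun setT v, forall x, 0 <= v x &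
    {ae mu, forall x, D x -> `|u x|%:E = (v x)%:E}].
Proof.
move=> [s_ s_simple s_cvg].
(* The upper limit exists and is measurable everywhere, even where [s_] diverges; [fine] and the
   outer absolute value keep it real and nonnegative there. *)
exists (fun x => `|fine (limn_esup (fun n => `|s_ n x|%:E))|); split => //.
  apply: measurableT_comp => //; apply: (measurableT_comp (fine_measurable _)) => //.
  apply: measurable_fun_limn_esup => n; apply/measurable_EFinP.
  exact: measurable_vsimple_norm.
apply: filterS s_cvg => x /[apply] sx.
have nsx : `|s_ n x|%:E @[n --> \oo] --> `|u x|%:E.
  by apply: cvg_EFin; [exact: nearW|exact: cvg_norm].
rewrite is_cvg_limn_esupE; last by apply/cvg_ex; exists `|u x|%:E.
by rewrite (cvg_lim _ nsx)//= normr_id.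
Qed.

Variable D : set U.
Hypothesis mD : measurable D.
Local Open Scope ereal_scope.

Lemma integral_vsimple_norm (s : U -> X) : vsimple s ->
  \int[mu]_(x in D) `|s x|%:E =
  \sum_(y \in range s) `|y|%:E * mu (D `&` s @^-1` [set y]).
Proof.
move=> vs; have [sfin sm] := vs.
transitivity (\int[mu]_(x in D)
    \sum_(y \in range s) (`|y| * \1_(s @^-1` [set y]) x)%:E).
  apply: eq_integral => x _; rewrite fsumEFin//; congr EFin.
  rewrite (fsbigD1 (s x))//=; last by exists x.
  rewrite indicE mem_set//= mulr1 fsbig1 ?addr0// => y [_ ysx].
  rewrite indicE memNset ?mulr0//= => sxy; exact: ysx.
rewrite ge0_integral_fsum//; last first.
  move=> y; apply/measurable_EFinP; exact: measurable_funM.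
apply: eq_fsbigr => y _.
under eq_integral do rewrite EFinM.
rewrite ge0_integralZl//.
  by rewrite integral_indic// setIC.
by apply/measurable_EFinP; exact: measurable_indic.
Qed.

Lemma vsimple_integral_le_norm (s : U -> X) : vsimple_integrable mu D s ->
  `|vsimple_integral mu D s|%:E <= \int[mu]_(x in D) `|s x|%:E.
Proof.
move=> [vs sfin]; rewrite integral_vsimple_norm// /vsimple_integral.
have rs := vs.1; rewrite !fsbig_finite//=.
rewrite (le_trans (y := (\sum_(y <- finmap.enum_fset (fset_set (range s)))
   `|fine (mu (D `&` s @^-1` [set y])) *: y|)%:E))//.
  by rewrite lee_fin; exact: ler_norm_sum.
rewrite -sumEFin; apply: lee_sum => y _.
(* Only the level set of 0 may have infinite measure, and its term vanishes. *)
have [->|y0] := eqVneq y 0%R; first by rewrite scaler0 normr0 mul0e.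
rewrite normrZ mulrC EFinM ger0_norm ?fine_ge0// fineK// ge0_fin_numE//.
exact: sfin.
Qed.

(** The estimate for simple functions passes to the limit, since their norms exceed that of [F] by
    at most the norm of the difference, whose integral tends to 0. The Borel representative [v] of
    the norm of [F] permits splitting the integral. *)
Lemma bochner_integral_le_norm (F : U -> X) (I : X) :
  is_bochner_integral mu D F I -> `|I|%:E <= \int[mu]_(x in D) `|F x|%:E.
Proof.
move=> [Fm [s_ [s_int s_cvg s_I]]].
have [v [mv v0 Fv]] := strongly_measurable_norm _ _ Fm.
have sF n : `|vsimple_integral mu D (s_ n)|%:E <=
    \int[mu]_(x in D) `|F x - s_ n x|%:E + \int[mu]_(x in D) `|F x|%:E.
  apply: le_trans (vsimple_integral_le_norm _ _) _ => //.
  apply: (ge0_le_integralD _ _ mD _ _ _ v) => // x _.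
  rewrite -EFinD lee_fin -{1}(subrK (F x) (s_ n x)).
  by rewrite (le_trans (ler_normD _ _))// distrC.
have [->|Foo] := eqVneq (\int[mu]_(x in D) `|F x|%:E) +oo; first by rewrite leey.
have Ifin : \int[mu]_(x in D) `|F x|%:E \is a fin_num.
  by rewrite ge0_fin_numE ?lt_neqAle ?Foo ?leey// integral_ge0.
have cI : `|vsimple_integral mu D (s_ n)|%:E @[n --> \oo] --> `|I|%:E.
  by apply: cvg_EFin; [exact: nearW|exact: cvg_norm].
have cF : \int[mu]_(x in D) `|F x - s_ n x|%:E + \int[mu]_(x in D) `|F x|%:E
    @[n --> \oo] --> \int[mu]_(x in D) `|F x|%:E.
  rewrite -[X in _ --> X]add0e; apply: cvgeD; last exact: cvg_cst.
    exact: fin_num_adde_defl.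
  exact: s_cvg.
rewrite -(cvg_lim _ cI)// -(cvg_lim _ cF)//.
apply: lee_lim; [by apply/cvg_ex; eexists; exact: cI|by apply/cvg_ex; eexists; exact: cF|].
exact: nearW.
Qed.

End BochnerNorm.

(** * Translation of integrals on the line *)

Section Translation.
Context {R : realType}.
Local Notation mu := (@lebesgue_measure R).

(** The pushforward gives half-open intervals their length, which characterizes Lebesgue measure. *)
Lemma lebesgue_measure_translate (a : R) (A : set R) : measurable A ->
  pushforward mu (fun x : R => x + a : measurableTypeR R) A = mu A.
Proof.
move=> mA; apply/esym/lebesgue_measure_unique => //=.
  by apply: measurable_funD => //; exact: measurable_cst.
move=> ? _ [[b c]] _ <-.
rewrite /pushforward (_ : _ @^-1` _ = `]b - a, c - a]%classic); last first.
  by apply/seteqP; split => x /=; rewrite !in_itv/= ltrBlDr lerBrDr.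
rewrite !lebesgue_measure_itv/= !lte_fin ltrD2r; case: ifPn => // _.
by rewrite -!EFinB; congr EFin; ring.
Qed.

(** The change of variables is made on measurable minorants of [f], whose translates are minorants
    of the translate of [f]. *)
Lemma le_integral_translate (f : R -> \bar R) (a b c : R) :
  (forall x, (0 <= f x)%E) ->
  (\int[mu]_(x in `[(b + a)%R, (c + a)%R]) f x <=
   \int[mu]_(x in `[b, c]) f (x + a)%R)%E.
Proof.
move=> f0; apply: integral_le_measurable_minorants => // h mh h0 hf.
have -> : (\int[mu]_(x in `[(b + a)%R, (c + a)%R]) (h x)%:E =
    \int[mu]_(x in `[b, c]) (h (x + a)%R)%:E)%E.
  rewrite (_ : `[b, c]%classic =
      (fun x : R => x + a : measurableTypeR R) @^-1` `[(b + a)%R, (c + a)%R]); last first.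
    by apply/seteqP; split => x /=; rewrite !in_itv/= !lerD2r.
  have mshift : measurable_fun setT (fun x : measurableTypeR R => x + a : measurableTypeR R).
    by apply: measurable_funD => //; exact: measurable_cst.
  rewrite -[RHS](ge0_integral_pushforward mshift mu (f := EFin \o h)); last 3 first.
  - exact: measurable_itv.
  - by apply/measurable_EFinP; exact: measurable_funTS.
  - by move=> x _; rewrite lee_fin.
  apply: eq_measure_integral => //= A mA _.
  exact/esym/lebesgue_measure_translate.
apply: le_ge0_integral => x; rewrite /= in_itv/= => /andP[bx xc].
  by rewrite lee_fin.
by apply: hf; rewrite /= in_itv/= !lerD2r bx.
Qed.

End Translation.

(** * Uniform smallness of integrals over short intervals *)

Section EquiIntegrability.
Context {R : realType} {Y : normedModType R}.
Local Notation mu := (@lebesgue_measure R).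

Lemma L1loc_near0 (v : R -> Y) (e : R) : L1loc v -> 0 < e ->
  exists2 h : R, 0 < h & (\int[mu]_(s in `[(- h)%R, 0%R]) `|v s|%:E < e%:E)%E.
Proof.
move=> [vm vint] e0.
have [w [mw w0 vw]] := strongly_measurable_norm _ _ _ vm.
pose J : set R := `[-1, 0]%classic.
have mJ : measurable J by exact: measurable_itv.
have aew (K : set R) : measurable K ->
    (\int[mu]_(s in K) `|v s|%:E = \int[mu]_(s in K) (w s)%:E)%E.
  move=> mK; apply/eqP; rewrite eq_le; apply/andP; split;
    apply: ae_le_ge0_integral => //.
  - by move=> x _; rewrite lee_fin.
  - by apply: filterS vw => x /(_ I) -> _.
  - by move=> x _; rewrite lee_fin.
  - by apply: filterS vw => x /(_ I) -> _.
have wJint : mu.-integrable setT (EFin \o (w \_ J)).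
  apply/integrableP; split.
    apply/measurable_EFinP; apply/(measurable_restrictT _ _).1 => //.
    exact: measurable_funTS.
  rewrite (_ : (\int[mu]_x _ = \int[mu]_(x in J) (w x)%:E)%E).
    rewrite -aew//; apply: vint; exact: segment_compact.
  rewrite [RHS]integral_mkcond; apply: eq_integral => x _ /=.
  by rewrite !patchE; case: ifP => _; rewrite ?normr0// ger0_norm.
have [d [d0 dP]] := integral_normr_continuous wJint e0.
(* The bound 1 keeps the interval inside [J]; [d / 2] makes its measure strictly less than [d]. *)
pose h : R := Num.min 1 (d / 2); exists h; first by rewrite lt_min divr_gt0// andbT.
have h0 : 0 < h by rewrite lt_min divr_gt0// andbT.
have h1 : h <= 1 by rewrite ge_min lexx.
have hd : h < d by rewrite gt_min; apply/orP; right; lra.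
have mh : measurable `[- h, 0]%classic by exact: measurable_itv.
have hJ : `[- h, 0]%classic `<=` J.
  move=> x; rewrite /J /= !in_itv/= => /andP[hx ->].
  by rewrite andbT (le_trans _ hx)// lerN2.
have /(dP _ mh) : (mu `[(- h)%R, 0%R]%classic < d%:E)%E.
  by rewrite lebesgue_measure_itv/= lte_fin oppr_lt0 h0 -EFinB opprK add0r lte_fin.
rewrite aew//.
have -> : (\int[mu]_(s in `[(- h)%R, 0%R]) (w s)%:E =
    \int[mu]_(s in `[(- h)%R, 0%R]) `|(w \_ J) s|%:E)%E.
  apply: eq_integral => x /set_mem /hJ xJ.
  by rewrite patchE mem_set// ger0_norm.
rewrite /Rintegral -lte_fin fineK//.
have := integrable_abse (@integrableS _ _ _ mu _ _ _ measurableT mh (@subsetT _ _) wJint).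
by move=> /integrable_fin_num; apply.
Qed.

Lemma AAS1_equi_integrable (u : R -> Y) (e : R) : AAS1 u -> 0 < e ->
  \forall h \near 0^'+, forall t,
    (\int[mu]_(s in `[(t - h)%R, t]) `|u s|%:E <= e%:E)%E.
Proof.
move=> [_ uAAS] e0.
(* One length is enough, as shorter intervals have smaller integrals; lengths [1 / (n + 1)] let the
   negation produce a sequence of endpoints. *)
suff [n nP] : exists n : nat, forall t,
    (\int[mu]_(s in `[(t - n.+1%:R^-1)%R, t]) `|u s|%:E <= e%:E)%E.
  near=> h => t; apply: le_trans (nP t).
  apply: subset_ge0_integral => [x /=|x _]; last by rewrite lee_fin.
  rewrite !in_itv/= => /andP[hx ->]; rewrite andbT.
  rewrite (le_trans _ hx)// lerB//; near: h; apply: nbhs_right_le.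
  by rewrite invr_gt0.
apply: contrapT => /forallNP H.
have {}H n : exists t, (e%:E < \int[mu]_(s in `[(t - n.+1%:R^-1)%R, t]) `|u s|%:E)%E.
  by have /existsNP[t /negP] := H n; rewrite -ltNge => ?; exists t.
pose r n := projT1 (cid (H n)).
have rP n : (e%:E < \int[mu]_(s in `[(r n - n.+1%:R^-1)%R, r n]) `|u s|%:E)%E :=
  projT2 (cid (H n)).
have [k [k_incr [v [vL1 uv _]]]] := uAAS r.
have e2 : 0 < e / 2 by rewrite divr_gt0.
have [w [mw w0 vw]] := strongly_measurable_norm _ _ _ vL1.1.
have [h h0 vh] := L1loc_near0 _ _ vL1 e2.
have uvn : \forall n \near \oo,
    (\int[mu]_(s in `[(- 1)%R, 0%R]) `|u (s + r (k n)) - v s|%:E < (e / 2)%:E)%E.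
  (* The window starting at -1 is [[-1, 0]], which contains all the translated short intervals. *)
  have := uv (-1); rewrite addNr => /(_ [set x | (x < (e / 2)%:E)%E]); apply.
  by apply: open_nbhs_nbhs; split; [exact: open_ereal_lt_ereal|rewrite /= lte_fin].
have hn : \forall n \near \oo, n.+1%:R^-1 < h.
  exact: near_infty_natSinv_lt (PosNum h0).
have [n [{}uvn {}hn]] := filter_ex (filterI uvn hn).
(* The interval attached to [r (k n)] has length [1 / (k n + 1)], hence at most
   [1 / (n + 1) < h]. *)
have nk : (n <= k n)%N.
  elim: n {uvn hn} => // n IH; apply: leq_ltn_trans IH _; exact: k_incr.
have := rP (k n); apply/negP; rewrite -leNgt.
set t := r (k n); set c := (k n).+1%:R^-1.
have c1 : c <= 1 by rewrite invf_le1// ler1n.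
have ch : c <= h by rewrite (le_trans _ (ltW hn))// lef_pV2 ?posrE ?ltr0n// ler_nat.
have -> : `[t - c, t]%classic = `[- c + t, 0 + t]%classic by rewrite add0r addrC.
apply: le_trans (le_integral_translate (fun s => `|u s|%:E) _ _ _ _) _ => //.
apply: (@le_trans _ _ (\int[mu]_(s in `[(- c)%R, 0%R]) `|u (s + t) - v s|%:E +
    \int[mu]_(s in `[(- c)%R, 0%R]) `|v s|%:E)%E).
  apply: (ge0_le_integralD mu _ (measurable_itv `[- c, 0]) _ _ _ w) => //.
    by apply: filterS vw => x /(_ I).
  move=> x _; rewrite -EFinD lee_fin -{1}(subrK (v x) (u (x + t))).
  exact: ler_normD.
rewrite (splitr e) EFinD; apply: leeD.
  apply: le_trans (ltW uvn); apply: subset_ge0_integral => // x /=.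
  by rewrite !in_itv/= => /andP[cx ->]; rewrite andbT (le_trans _ cx)// lerN2.
apply: le_trans (ltW vh); apply: subset_ge0_integral => // x /=.
by rewrite !in_itv/= => /andP[cx ->]; rewrite andbT (le_trans _ cx)// lerN2.
Unshelve. all: by end_near. Qed.

End EquiIntegrability.

(** Total boundedness in ultrafilter form: an ultrafilter containing [closure A] contains a ball of
    every radius, so it is Cauchy and converges by completeness. *)
Lemma precompact_approximable {R : realType} {X : completeNormedModType R}
    (A : set X) :
  (forall e : R, 0 < e -> exists2 K : set X, precompact K &
    forall x, A x -> exists2 y, K y & `|x - y| <= e) ->
  precompact A.
Proof.
move=> AK; rewrite precompactE compact_ultra => F UF FA.
suff : cauchy F.
  move=> /cauchy_cvgP Fcvg; exists (lim F); split => //.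
  have Fid : id x @[x --> F] --> lim F by exact: Fcvg.
  exact: (@closed_cvg _ _ F _ id (closure A) (@closed_closure _ A) FA _ Fid).
apply/cauchy_exP => e e0.
(* Three distances are added below: from [x] in the closure to [z] in [A], from [z] to [y] in [K],
   and from [y] to a centre [c]. Three quarters of [e] stay below [e]. *)
have e4 : 0 < e / 4 by rewrite divr_gt0.
have [K Kc KA] := AK _ e4.
move: Kc; rewrite precompactE compact_cover.
case/(_ X (closure K) (fun y => ball y (e / 4))).
- by move=> y _; exact: ball_open.
- by move=> y Ky; exists y => //; exact: ballxx.
(* If no ball of radius [e] is in the ultrafilter, the complements of the finitely many balls
   centred in [D] are, and so is their intersection with [closure A]. *)
move=> D _ KD; apply: contrapT => /forallNP Fe.
have /filter_ex[x [clAx Dx]] : F (closure A `&` \bigcap_(y in [set` D]) ~` ball y e).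
  apply: filterI => //; apply: filter_bigI => y _.
  by have [/Fe|] := in_ultra_setVsetC (ball y e) UF.
have [z [Az xz]] := clAx _ (nbhsx_ballx x _ e4).
have [y Ky zy] := KA _ Az.
have [c cD cy] := KD _ (subset_closure Ky).
apply: (Dx c) => //.
move: xz cy; rewrite -!ball_normE /ball_/= => xz cy.
have := ler_distD y c x; have := ler_distD z y x.
rewrite (distrC y z) (distrC z x); lra.
Qed.

(** * Boundedness of the semigroup near time 0 *)

Lemma C0_semigroup_bounded_near0 {R : realType} {X : completeNormedModType R}
    (T : R -> X -> X) : C0_semigroup T ->
  exists2 M : R, 0 < M & \forall h \near 0^'+, forall s, 0 <= s <= h ->
    forall x, `|T s x| <= M * `|x|.
Proof.
move=> [Tlc T0 _ Tcvg].
(* The same [n] governs the time span and the bound, so failure for all [n] gives times tending to 0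
   with operators unbounded on the unit ball, against Banach-Steinhaus. *)
suff [n nT] : exists n : nat, forall s, 0 <= s <= n.+1%:R^-1 ->
    forall x, `|x| <= 1 -> `|T s x| <= n.+1%:R.
  exists n.+1%:R => //; near=> h => s /andP[s0 sh] x.
  have TZ a y : T s (a *: y) = a *: T s y.
    have [lT _] := Tlc s s0.
    pose L : {linear X -> X} :=
      HB.pack (T s) (GRing.isLinear.Build _ _ _ _ _ lT).
    exact: (linearZ_LR L).
  have [->|x0] := eqVneq x 0.
    by have := TZ 0 0; rewrite !scale0r => ->; rewrite normr0 mulr0.
  have xgt0 : 0 < `|x| by rewrite normr_gt0.
  have sn : 0 <= s <= n.+1%:R^-1.
    rewrite s0 (le_trans sh)//; near: h.
    apply: nbhs_right_le; by rewrite invr_gt0.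
  have /(nT _ sn) : `|(`|x|^-1 *: x)| <= 1.
    by rewrite normrZ normfV normr_id mulVf// gt_eqF.
  rewrite TZ normrZ normfV normr_id mulrC ler_pdivrMr//.
apply: contrapT => /forallNP H.
have {}H n : exists sx : R * X, [/\ 0 <= sx.1 <= n.+1%:R^-1, `|sx.2| <= 1 &
    n.+1%:R < `|T sx.1 sx.2|].
  have /existsNP[s /not_implyP[s0 /existsNP[x /not_implyP[x1 /negP]]]] := H n.
  by rewrite -ltNge => Tsx; exists (s, x).
pose sx n := projT1 (cid (H n)).
have sxP n : [/\ 0 <= (sx n).1 <= n.+1%:R^-1, `|(sx n).2| <= 1 &
    n.+1%:R < `|T (sx n).1 (sx n).2|] := projT2 (cid (H n)).
have /Banach_Steinhauss : forall f, range (fun n => T (sx n).1) f ->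
    bounded_fun_norm f /\ linear f.
  move=> _ [n _ <-]; have [/andP[s0 _] _ _] := sxP n.
  have [lT cT] := Tlc _ s0; split => //.
  pose L : {linear X -> X} := HB.pack (T (sx n).1) (GRing.isLinear.Build _ _ _ _ _ lT).
  have /linear_bounded_continuous : continuous L by [].
  by move=> /bounded_funP.
case/(_ _ 1).
  move=> x.
  have /cvgrPdist_le/(_ 1 ltr01) := Tcvg x.
  rewrite near_withinE => /nbhs_ballP[e /= e0 He].
  have Tx s : 0 <= s < e -> `|T s x| <= `|x| + 1.
    (* The right limit at 0 says nothing about [s = 0], where [T 0 = id] is used instead. *)
    move=> /andP[]; rewrite le_eqVlt => /predU1P[<- _|s0 se].
      by rewrite T0 lerDl.
    have : `|x - T s x| <= 1.
      apply: He => //=; rewrite /ball/= sub0r normrN gtr0_norm//.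
    rewrite -lerBlDl; apply: le_trans; rewrite distrC; exact: lerB_dist.
  have [N _ NH] : \forall n \near \oo, n.+1%:R^-1 < e.
    exact: near_infty_natSinv_lt (PosNum e0).
  (* Strong continuity bounds the orbit of [x] from index [N] on; the sum covers the finitely many
     earlier times. *)
  exists (`|x| + 1 + \sum_(i < N) `|T (sx i).1 x|) => _ [n _ <-].
  have [/andP[s0 sn] _ _] := sxP n.
  have [nN|Nn] := ltnP n N.
    rewrite (bigD1 (Ordinal nN))//= addrCA lerDl addr_ge0// ?addr_ge0//.
    by rewrite sumr_ge0.
  apply: le_trans (Tx _ _) _; last by rewrite lerDl sumr_ge0.
  by rewrite s0 (le_lt_trans sn)//; exact: NH.
move=> M HM.
have [n nM] : exists n : nat, M < n.+1%:R.
  by exists (Num.truncn M); exact: truncnS_gt.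
have [_ x1 /lt_le_trans] := sxP n.
have /(_ _ _ x1)H1 := HM (T (sx n).1).
by move=> /(_ _ (H1 (ex_intro2 _ _ n I erefl))); rewrite ltNge ltW.
Unshelve. all: by end_near. Qed.

(** * Approximation of the range by precompact sets *)

Theorem lemma3p8 (R : realType) (X : completeNormedModType R)
    (D : set X) (A : X -> X) (T : R -> X -> X)
    (phi : R -> R^o) (psi : R -> X) (g : X -> X) (f : R -> X -> X)
    (t0 : R) (x0 : R -> X)
    (T_semigroup : C0_semigroup T)
    (A_generator : is_generator D A T)
    (T_compact : forall t, 0 < t -> compact_operator (T t))
    (phi_AAS1 : AAS1 phi) (phi_Linfty : Linfty phi)
    (psi_AAS1 : AAS1 psi)
    (g_continuous : continuous g)
    (g_bounded : forall B : set X, bounded_set B -> bounded_set (g @` B))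
    (f_def : forall t x, f t x = phi t *: g x + psi t)
    (x0_mild : mild_solution T f t0 x0)
    (x0_bounded : bounded_set (x0 @` `[t0, +oo[)) :
  precompact (x0 @` `[t0, +oo[).
Proof.
have [x0_cont x0_eq] := x0_mild.
have [M M0 TM] := C0_semigroup_bounded_near0 _ T_semigroup.
have [G G0 gG] : exists2 G : R, 0 < G & forall s, t0 <= s -> `|g (x0 s)| <= G.
  have [G [_ gG]] := g_bounded _ x0_bounded.
  exists (Num.max G 0 + 1); first by rewrite ltr_wpDl// le_max lexx orbT.
  move=> s ts; apply: (gG (Num.max G 0 + 1)).
    by rewrite ltr_pwDr// le_max lexx.
  by exists (x0 s) => //; exists s => //=; rewrite in_itv/= ts.
apply: precompact_approximable => e e0.
(* Chosen so that the [phi] part, weighted by [M * G], and the [psi] part, weighted by [M], each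
   contribute at most [e / 2]. *)
have ephi0 : 0 < e / 2 / (M * G) by rewrite !divr_gt0// mulr_gt0.
have epsi0 : 0 < e / 2 / M by rewrite !divr_gt0.
have [h [h0 Th phih psih]] : exists h : R, [/\ 0 < h,
    forall s, 0 <= s <= h -> forall x, `|T s x| <= M * `|x|,
    forall t, (\int[lebesgue_measure]_(s in `[(t - h)%R, t]) `|phi s|%:E <=
      (e / 2 / (M * G))%:E)%E &
    forall t, (\int[lebesgue_measure]_(s in `[(t - h)%R, t]) `|psi s|%:E <=
      (e / 2 / M)%:E)%E].
  suff /filter_ex[h [[Th [phih psih]] h0]] : \forall h \near 0^'+,
      ((forall s, 0 <= s <= h -> forall x, `|T s x| <= M * `|x|) /\
      ((forall t, (\int[lebesgue_measure]_(s in `[(t - h)%R, t]) `|phi s|%:E <=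
      (e / 2 / (M * G))%:E)%E) /\
      (forall t, (\int[lebesgue_measure]_(s in `[(t - h)%R, t]) `|psi s|%:E <=
      (e / 2 / M)%:E)%E))) /\ 0 < h.
    by exists h.
  apply: filterI; last exact: nbhs_right_gt.
  apply: filterI; first exact: TM.
  by apply: filterI; exact: AAS1_equi_integrable.
exists (x0 @` `[t0, t0 + h] `|` T h @` (x0 @` `[t0, +oo[)).
  rewrite precompactE closureU; apply: compactU; rewrite -precompactE.
    apply: compact_precompact; first exact: norm_hausdorff.
    apply: continuous_compact; last exact: segment_compact.
    apply: continuous_subspaceW x0_cont => s /=.
    by rewrite !in_itv/= => /andP[->].
  by have [_ _] := T_compact _ h0; apply.
move=> _ [t /= + <-]; rewrite in_itv/= andbT => t0t.
have [tth|tht] := leP t (t0 + h).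
  exists (x0 t); last by rewrite subrr normr0 ltW.
  by left; exists t => //=; rewrite in_itv/= t0t.
have t0th : t0 <= t - h by rewrite lerBrDr ltW.
have tht' : t - h <= t by rewrite gerBl ltW.
exists (T h (x0 (t - h))).
  by right; exists (x0 (t - h)) => //; exists (t - h) => //=; rewrite in_itv/= t0th.
have [Fint ->] := x0_eq _ _ t0th tht'.
rewrite subKr addrAC subrr add0r.
set F := fun s => T (t - s) (f s (x0 s)).
have mJ : measurable `[t - h, t]%classic by exact: measurable_itv.
(* Integrability of [F] ensures that [xget] returns an actual integral, not the default 0. *)
have := bochner_integral_le_norm (@lebesgue_measure R) _ mJ _ _ (xgetPex 0 Fint).
rewrite -/(bochner_integral _ _ _) -lee_fin => /le_trans; apply.
(* [M * w] is the Borel representative of the [psi] summand that allows the integral to be split. *)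
have [w [mw w0 psiw]] := strongly_measurable_norm _ _ _ psi_AAS1.1.1.
apply: (@le_trans _ _ (\int[lebesgue_measure]_(s in `[(t - h)%R, t])
    ((M * G)%:E * `|phi s|%:E) +
  \int[lebesgue_measure]_(s in `[(t - h)%R, t]) (M%:E * `|psi s|%:E))%E).
  apply: (ge0_le_integralD (@lebesgue_measure R) _ mJ _ _ _ (fun s => M * w s)) => //.
  - by move=> s _; rewrite -EFinM lee_fin !mulr_ge0// ltW.
  - by move=> s _; rewrite -EFinM lee_fin mulr_ge0// ltW.
  - exact: measurable_funM.
  - by move=> s; rewrite mulr_ge0// ltW.
  - by apply: filterS psiw => s /(_ I) -> _; rewrite -EFinM.
  move=> s /=; rewrite in_itv/= => /andP[ths st].
  rewrite -!EFinM -EFinD lee_fin -mulrA -mulrDr.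
  apply: le_trans (Th _ _ _) _.
    by rewrite subr_ge0 st/= lerBlDr -lerBlDl.
  rewrite ler_pM2l// f_def (le_trans (ler_normD _ _))// lerD2r normrZ mulrC.
  by rewrite ler_wpM2r// gG// (le_trans t0th).
rewrite (splitr e) EFinD; apply: leeD.
  apply: le_trans (ge0_le_integralZl (@lebesgue_measure R) _ mJ _ _ _ _) _ => //.
    exact: mulr_gt0.
  by rewrite -lee_pdivlMl ?mulr_gt0// -EFinM mulrC.
apply: le_trans (ge0_le_integralZl (@lebesgue_measure R) _ mJ _ _ _ _) _ => //.
by rewrite -lee_pdivlMl// -EFinM mulrC.
Qed.
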